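(* Given $f$ on $\{-2N,\ldots,2N\}^d$, suppose that $\boldsymbol{\Theta}_f$ is positive semidefinite and has rank $K$, where $K\le 2N$. Then $f$ can be written as $$f(\boldsymbol{x})=\sum_{k=1}^K c_k e^{i\,\xi_k\cdot\boldsymbol{x}},$$ where $c_k>0$ and $\xi_k\in\mathbb{R}^d$ are distinct and unique. Conversely, if $f$ has this form, then $\boldsymbol{\Theta}_f$ is positive semidefinite with rank $K$.
   Context: Let $\boldsymbol{\Upsilon}=\boldsymbol{\Xi}=\{-N,\ldots,N\}^d$ and $\boldsymbol{\Omega}=\{-2N,\ldots,2N\}^d$, with $N,d$ positive integers. For a complex-valued function $f$ on $\boldsymbol{\Omega}$, the operator $\boldsymbol{\Theta}_f$ maps functions $g$ on $\boldsymbol{\Upsilon}$ to functions on $\boldsymbol{\Xi}$ by $$\boldsymbol{\Theta}_f(g)(\boldsymbol{x})=\sum_{\boldsymbol{y}\in\boldsymbol{\Upsilon}} f(\boldsymbol{x}-\boldsymbol{y})g(\boldsymbol{y}),\qquad \boldsymbol{x}\in\boldsymbol{\Xi}.$$ (In the lexicographical order its matrix is a block Toeplitz matrix.) It is positive semidefinite if $\langle\boldsymbol{\Theta}_f g,g\rangle\ge 0$ for all functions $g$ on $\boldsymbol{\Upsilon}$, where $\langle h,g\rangle=\sum_{\boldsymbol{x}}h(\boldsymbol{x})\overline{g(\boldsymbol{x})}$. Here $\xi\cdot\boldsymbol{x}=\sum_{m=1}^d\xi_m x_m$.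
   Formalization: The frequencies ξ_k are taken to be distinct, and unique up to relabelling, modulo 2πℤ^d rather than in ℝ^d, since shifting ξ_k by 2π in a coordinate does not change f; the converse is stated with K ≤ 2N. *)

(* Defs.v *)
From HB Require Import structures.
From mathcomp Require Import all_boot all_order all_algebra all_fingroup.
From mathcomp Require Import reals trigo.
From mathcomp Require Export complex.
From mathcomp Require Import zify.
Set Implicit Arguments.
Unset Strict Implicit.
Unset Printing Implicit Defensive.
Import Order.TTheory GRing.Theory Num.Theory.
Local Open Scope ring_scope.
Local Open Scope complex_scope.

(* The grid {-M, ..., M}^d. Coordinates are stored with an offset of M, so that
   an ordinal j < 2M+1 stands for the integer j - M; see [coord]. *)
Definition box (M d : nat) := {ffun 'I_d -> 'I_(2 * M).+1}.

Definition coord (M d : nat) (x : box M d) (m : 'I_d) : int :=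
  (x m)%:Z - M%:Z.

Lemma coord_inj (M d : nat) (x y : box M d) : coord x =1 coord y -> x = y.
Proof.
move=> e; apply/ffunP => m; apply/val_inj; move: (e m); rewrite /coord /=.
lia.
Qed.

Lemma coord_bound (M d : nat) (x : box M d) (m : 'I_d) :
  - M%:Z <= coord x m <= M%:Z.
Proof. by rewrite /coord; have := ltn_ord (x m); lia. Qed.

Lemma coord_surj (M d : nat) (z : 'I_d -> int) :
  (forall m, - M%:Z <= z m <= M%:Z) -> exists x : box M d, coord x =1 z.
Proof.
move=> zM; exists [ffun m => inord (absz (z m + M%:Z))] => m.
by rewrite /coord ffunE inordK; move: (zM m); lia.
Qed.

(* The difference x - y, which lies in {-2N, ..., 2N}^d; see [coord_sub]. *)
Definition box_sub (N d : nat) (x y : box N d) : box (2 * N) d :=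
  [ffun m => inord (x m + (2 * N - y m))].

Lemma coord_sub (N d : nat) (x y : box N d) (m : 'I_d) :
  coord (box_sub x y) m = coord x m - coord y m.
Proof.
rewrite /coord /box_sub ffunE inordK;
  by have := ltn_ord (x m); have := ltn_ord (y m); lia.
Qed.

(* C^o is C regarded as a module over itself: it makes the functions on a grid
   a finite-dimensional vector space over the complex numbers. *)
Notation cfun R M d := {ffun box M d -> R[i]^o}.

Definition Theta_fun (R : realType) (N d : nat) (f : cfun R (2 * N) d)
    (g : cfun R N d) : cfun R N d :=
  [ffun x => \sum_(y : box N d) (f (box_sub x y) : R[i]) * g y].

Lemma Theta_fun_linear (R : realType) (N d : nat) (f : cfun R (2 * N) d) :
  linear (Theta_fun f).
Proof.
move=> a g h; apply/ffunP => x; rewrite !ffunE scaler_sumr -big_split /=.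
by apply: eq_bigr => y _; rewrite !ffunE mulrDr; congr (_ + _); exact: mulrCA.
Qed.

HB.instance Definition _ (R : realType) (N d : nat) (f : cfun R (2 * N) d) :=
  GRing.isLinear.Build R[i] (cfun R N d) (cfun R N d) *:%R (Theta_fun f)
    (Theta_fun_linear f).

Definition Theta (R : realType) (N d : nat) (f : cfun R (2 * N) d) :
  'End(cfun R N d) := linfun (Theta_fun f).

Lemma ThetaE (R : realType) (N d : nat) (f : cfun R (2 * N) d)
    (g : cfun R N d) (x : box N d) :
  Theta f g x = \sum_(y : box N d) (f (box_sub x y) : R[i]) * g y.
Proof. by rewrite /Theta lfunE /= ffunE. Qed.

Definition oprank (R : realType) (N d : nat) (T : 'End(cfun R N d)) : nat :=
  \dim (limg T).

Definition inner (R : realType) (N d : nat) (h g : cfun R N d) : R[i] :=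
  \sum_(x : box N d) (h x : R[i]) * (g x : R[i])^*.

(* In R[i], 0 <= z means that z is real and nonnegative. *)
Definition psd (R : realType) (N d : nat) (T : 'End(cfun R N d)) : Prop :=
  forall g : cfun R N d, 0 <= inner (T g) g.

Definition expi (R : realType) (t : R) : R[i] := cos t +i* sin t.

Definition dotp (R : realType) (M d : nat) (xi : 'rV[R]_d) (x : box M d) : R :=
  \sum_(m < d) xi 0 m * (coord x m)%:~R.

(* Equality of frequencies modulo 2 pi Z^d: since x has integer coordinates,
   x |-> exp(i xi.x) only depends on the class of xi. Distinctness and uniqueness
   of frequencies are therefore understood in R^d / 2 pi Z^d. *)
Definition eqfreq (R : realType) (d : nat) (xi eta : 'rV[R]_d) : Prop :=
  forall m : 'I_d, exists z : int, xi 0 m = eta 0 m + 2 * pi * z%:~R.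

Definition is_expsum (R : realType) (N d K : nat) (f : cfun R (2 * N) d)
    (c : 'I_K -> R) (xi : 'I_K -> 'rV[R]_d) : Prop :=
  [/\ forall k, 0 < c k,
      forall k l, k != l -> ~ eqfreq (xi k) (xi l)
    & forall x : box (2 * N) d,
        f x = \sum_(k < K) (c k)%:C * expi (dotp (xi k) x)].

(* Main.v *)
Require Import Defs.
From mathcomp Require Import all_boot all_order all_algebra all_fingroup.
From mathcomp Require Import reals trigo.
From mathcomp Require Import zify ring lra.
Set Implicit Arguments.
Unset Strict Implicit.
Unset Printing Implicit Defensive.
Import Order.TTheory GRing.Theory Num.Theory.
Local Open Scope ring_scope.

(** A positive semidefinite operator of rank K is a Gram operator: there are
    vectors v_x in C^K, one for each point x of the small box and spanning
    C^K, with f(x - y) = <v_x, v_y> ([psdmx_gram], [oprank_toeplitz]).  Since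
    f(x - y) is unchanged when x and y are both moved one step along the axis
    m, so are the inner products, and therefore v_(x + e_m) = v_x U_m for some
    matrix U_m ([gram_factor]).

    The bound K <= 2N enters through a dimension count.  The spans of the
    vectors in the slabs x_m < j increase with j, and once two consecutive
    ones coincide all later ones do, because U_m carries each span into the
    next.  There are 2N+1 steps and the dimension is at most 2N, so the last
    step is not strict: the vectors that can still be moved along m span
    everything ([slab_span]).  Hence U_m is unitary, and the same count made
    inside a slab of another axis shows that the U_m commute
    ([bump_unitary]).  A common orthonormal eigenbasis turns v_x into
    (w_k e^(i xi_k.x))_k, so that f(x - y) is the sum over k of
    |w_k|^2 e^(i xi_k.(x - y)); as the v_x span C^K, no w_k vanishes and the
    xi_k are distinct modulo 2 pi ([gram_characters], [psd_expsum]).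

    The same count also gives linear independence of exponentials.  For any
    J <= 2M frequencies, the span of the vectors (e^(i xi_j.x))_j, x in the
    box of half-side M, is stable under the diagonal matrices
    diag(e^(i xi_(j,m)))_j, so Lagrange interpolation puts the indicator of
    each class of equal frequencies in that span ([class_separation]).  With
    J = K on the small box this yields the rank in the converse direction;
    with J = 2K on the large box, applied to two representations of f at once,
    it yields uniqueness ([expsum_term_match]). *)

(** * Positive semidefinite matrices and Gram factorizations *)

Section GramMatrices.
Local Open Scope sesquilinear_scope.
Variable C : numClosedFieldType.

Lemma adjmxM m n p (A : 'M[C]_(m, n)) (B : 'M[C]_(n, p)) :
  (A *m B)^t* = B^t* *m A^t*.
Proof. by rewrite trmx_mul map_mxM. Qed.

Lemma adjmx1 n : (1%:M : 'M[C]_n)^t* = 1%:M.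
Proof. by rewrite trmx1 map_mx1. Qed.

Lemma adjmx_diag n (D : 'rV[C]_n) :
  (diag_mx D)^t* = diag_mx (map_mx Num.conj D).
Proof. by rewrite tr_diag_mx map_diag_mx. Qed.

Lemma mulmx_adj_diag m n (A : 'M[C]_(m, n)) i :
  (A *m A^t*) i i = \sum_j `|A i j| ^+ 2.
Proof. by rewrite mxE; apply: eq_bigr => j _; rewrite !mxE normCK. Qed.

Lemma mulmx_adj_eq0 m n (A : 'M[C]_(m, n)) : A *m A^t* = 0 -> A = 0.
Proof.
move=> A0; apply/matrixP => i j; rewrite mxE.
have /eqP := mulmx_adj_diag A i; rewrite A0 mxE eq_sym psumr_eq0 => [|l _].
  by move=> /allP /(_ j (mem_index_enum _)); rewrite expf_eq0 normr_eq0 => /eqP.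
by rewrite exprn_ge0.
Qed.

(** The Gram matrix determines the vectors up to a linear map: X A = 0 forces
    the Gram matrix of X B to be X A A* X* = 0, so every linear relation
    between the rows of A holds between the rows of B. *)
Lemma gram_factor m n p (A : 'M[C]_(m, n)) (B : 'M[C]_(m, p)) :
  A *m A^t* = B *m B^t* -> exists M : 'M[C]_(n, p), B = A *m M.
Proof.
move=> AB; exists (pinvmx A *m B); set X := A *m pinvmx A - 1%:M.
have XA : X *m A = 0 by rewrite mulmxBl mul1mx mulmxKpV ?subrr.
have /mulmx_adj_eq0 XB : (X *m B) *m (X *m B)^t* = 0.
  by rewrite adjmxM mulmxA -(mulmxA X) -AB mulmxA XA !mul0mx.
by apply/esym/eqP; rewrite -subr_eq0 mulmxA -{2}(mul1mx B) -mulmxBl XB.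
Qed.

Lemma gram_factor_unitary m n (A B : 'M[C]_(m, n)) (M : 'M[C]_n) :
  A *m A^t* = B *m B^t* -> B = A *m M -> row_full A -> M \is unitarymx.
Proof.
move=> AB BM fA; apply/unitarymxP; apply: (row_full_inj fA).
have E : M *m M^t* *m A^t* = A^t*.
  apply: (row_full_inj fA).
  by rewrite AB BM adjmxM !mulmxA.
by rewrite mulmx1 -[RHS]trmxCK -E adjmxM adjmxM !trmxCK.
Qed.

Definition psdmx n (A : 'M[C]_n) :=
  forall u : 'rV[C]_n, 0 <= (u *m A *m u^t*) 0 0.

Lemma normal_diag n (A : 'M[C]_n) : A \is normalmx ->
  exists (P : 'M[C]_n) (D : 'rV[C]_n),
    [/\ P \is unitarymx, A = P^t* *m diag_mx D *m P
      & forall k, D 0 k = (row k P *m A *m (row k P)^t*) 0 0].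
Proof.
move=> /orthomx_spectralP; set P := spectralmx A; set D := spectral_diag A.
have Pu : P \is unitarymx := spectral_unitarymx A.
rewrite invmx_unitary // => AE; exists P, D; split=> // k.
have DE : diag_mx D = P *m A *m P^t*.
  rewrite AE !mulmxA (unitarymxP Pu) mul1mx -mulmxA.
  by rewrite (unitarymxP Pu) mulmx1.
have <- : diag_mx D k k = D 0 k by rewrite mxE eqxx.
rewrite DE -row_mul !mxE; apply: eq_bigr => j _.
by rewrite !mxE.
Qed.

(** Over the complex numbers positivity of the quadratic form already forces
    symmetry.  The difference A - A* is skew-Hermitian, hence normal, and its
    eigenvalues are values of u A u* - u A* u*, which is 0 because u A u* is
    real. *)
Lemma psdmx_herm n (A : 'M[C]_n) : psdmx A -> A^t* = A.
Proof.
move=> psdA; apply/esym/eqP; rewrite -subr_eq0; apply/eqP.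
set X := A - A^t*.
have XE : X^t* = - X by rewrite linearB /= map_mxB trmxCK opprB.
have [P [D [_ XD DE]]] : exists (P : 'M[C]_n) (D : 'rV[C]_n),
    [/\ P \is unitarymx, X = P^t* *m diag_mx D *m P
      & forall k, D 0 k = (row k P *m X *m (row k P)^t*) 0 0].
  by apply: normal_diag; apply/normalmxP; rewrite XE mulmxN mulNmx.
suff D0 : D = 0 by rewrite XD D0 linear0 mulmx0 mul0mx.
apply/rowP => k; rewrite DE; set u := row k P.
have uA : (u *m A^t* *m u^t*) 0 0 = (u *m A *m u^t*) 0 0.
  have -> : u *m A^t* *m u^t* = (u *m A *m u^t*)^t*.
    by rewrite !adjmxM trmxCK mulmxA.
  rewrite [LHS]mxE [X in Num.conj X]mxE; apply: conj_Creal; exact/ger0_real/psdA.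
by rewrite /X mulmxBr mulmxBl mxE [X in _ + X]mxE uA subrr mxE.
Qed.

Lemma psdmx_square n (A : 'M[C]_n) : psdmx A ->
  exists S : 'M[C]_n, A = S *m S^t*.
Proof.
move=> psdA; have [|P [D [_ AE DE]]] := @normal_diag _ A.
  by apply/normalmxP; rewrite psdmx_herm.
exists (P^t* *m diag_mx (map_mx sqrtC D)).
rewrite adjmxM trmxCK adjmx_diag mulmxA -(mulmxA (P^t*)) mulmx_diag {1}AE.
congr (_ *m diag_mx _ *m _); apply/rowP => k; rewrite !mxE.
rewrite conj_Creal ?ger0_real ?sqrtC_ge0 ?DE //.
by rewrite -expr2 sqrtCK.
Qed.

(** A square root of A has as many columns as A; to reach the rank one
    compresses A to its row space first.  With B a basis of the rows and B' a
    right inverse of B, the relation A = A B' B and its adjoint give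
    A = B* (B'* A B') B, and the K x K matrix in the middle has a square
    root. *)
Lemma psdmx_gram n K (A : 'M[C]_n) : psdmx A -> \rank A = K ->
  exists2 G : 'M[C]_(n, K), A = G *m G^t* & row_full G.
Proof.
move=> psdA rA; move: (psdmx_herm psdA) => hA.
pose B := row_base A; pose B' := pinvmx B.
have AB : A *m (B' *m B) = A.
  by rewrite mulmxA mulmxKpV ?eq_row_base.
have [S HS] : exists S : 'M[C]_(\rank A), B'^t* *m A *m B' = S *m S^t*.
  apply: psdmx_square => u.
  have -> : u *m (B'^t* *m A *m B') *m u^t* =
            (u *m B'^t*) *m A *m (u *m B'^t*)^t*.
    by rewrite adjmxM trmxCK !mulmxA.
  exact: psdA.
have AE : A = (B^t* *m S) *m (B^t* *m S)^t*.
  rewrite adjmxM trmxCK mulmxA -(mulmxA _ S) -HS.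
  transitivity ((A *m (B' *m B))^t* *m (B' *m B)).
    by rewrite AB hA AB.
  by rewrite adjmxM hA adjmxM !mulmxA.
case: _ / rA; exists (B^t* *m S) => //.
rewrite /row_full eqn_leq rank_leq_col /= [X in (\rank X <= _)%N]AE.
exact: mxrankM_maxl.
Qed.

Lemma rank_gram n K (G : 'M[C]_(n, K)) : row_full G -> \rank (G *m G^t*) = K.
Proof.
move=> fG; apply/eqP; rewrite eqn_leq.
rewrite (leq_trans (mxrankM_maxl _ _) (rank_leq_col _)) /=.
have /row_fullP [L LG] := fG.
have E : L *m (G *m G^t*) *m L^t* = 1%:M.
  by rewrite mulmxA LG mul1mx -adjmxM LG adjmx1.
rewrite -{1}(mxrank1 C K) -E.
exact: leq_trans (mxrankM_maxl _ _) (mxrankM_maxr _ _).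
Qed.

(** Triangularize the U_i and their adjoints simultaneously in an orthonormal
    basis: a matrix that is triangular together with its adjoint is
    diagonal.  The adjoints commute with the U_j since they are the inverses
    of the U_i. *)
Lemma commuting_unitary_diag (I : finType) n (U : I -> 'M[C]_n) :
  (forall i, U i \is unitarymx) -> (forall i j, U i *m U j = U j *m U i) ->
  exists P : 'M[C]_n, P \is unitarymx /\
  exists D : I -> 'rV[C]_n, forall i, U i = P^t* *m diag_mx (D i) *m P.
Proof.
move=> Uu Uc.
have VU i : (U i)^t* *m U i = 1%:M by apply/mulmx1C/unitarymxP.
have UV i : U i *m (U i)^t* = 1%:M by apply/unitarymxP.
have Uc' i j : (U i)^t* *m U j = U j *m (U i)^t*.
  rewrite -[LHS]mulmx1 -(UV i) mulmxA -(mulmxA _ (U j)) -Uc.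
  by rewrite !mulmxA VU mul1mx.
have Uc'' i j : (U i)^t* *m (U j)^t* = (U j)^t* *m (U i)^t*.
  by rewrite -!adjmxM Uc.
pose As := codom U ++ codom (fun i => (U i)^t*).
have [|P Pu /allP /= PA] := @cotrigonalization _ n As.
  move=> A B; rewrite !mem_cat => /orP [] /codomP [i ->] /orP [] /codomP [j ->];
  by rewrite /comm_mx.
have PV : P^t* *m P = 1%:M by apply/mulmx1C/unitarymxP.
exists P; split=> //; exists (fun i => \row_k (P *m U i *m P^t*) k k) => i.
set X := P *m U i *m P^t*.
have tX : is_trig_mx X.
  have : is_trig_mx (conjmx P (U i)).
    by apply: PA; rewrite mem_cat codom_f.
  by rewrite conjymx.
have tX' : is_trig_mx (X^t*).
  have : is_trig_mx (conjmx P ((U i)^t*)).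
    by apply: PA; rewrite mem_cat (codom_f (fun i => (U i)^t*)) orbT.
  by rewrite conjymx // !adjmxM trmxCK mulmxA.
suff <- : X = diag_mx (\row_k X k k).
  by rewrite /X !mulmxA PV mul1mx -mulmxA PV mulmx1.
apply/matrixP => k l; rewrite [RHS]mxE [X in _ = X *+ _]mxE.
case: (ltngtP k l) => [kl|lk|/val_inj ->].
- by rewrite (is_trig_mxP tX) // -val_eqE ltn_eqF.
- have /eqP := is_trig_mxP tX' _ _ lk.
  by rewrite mxE mxE conjC_eq0 => /eqP ->; rewrite -val_eqE gtn_eqF.
- by rewrite eqxx.
Qed.
End GramMatrices.

(** * Spans of vectors indexed by a box *)

Section RowSpans.
Variables (F : fieldType) (I : finType) (K : nat) (v : I -> 'rV[F]_K).

Definition rowspan (P : pred I) : 'M[F]_K := (\sum_(i | P i) <<v i>>)%MS.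

Lemma rowspan_in (P : pred I) i : P i -> (v i <= rowspan P)%MS.
Proof. by move=> Pi; rewrite (sumsmx_sup i) ?genmxE. Qed.

Lemma rowspan_sub (P : pred I) n (W : 'M[F]_(n, K)) :
  (forall i, P i -> (v i <= W)%MS) -> (rowspan P <= W)%MS.
Proof. by move=> vW; apply/sumsmx_subP => i Pi; rewrite genmxE vW. Qed.

Lemma rowspan_mul_sub (P : pred I) n p (M : 'M[F]_(K, p)) (W : 'M[F]_(n, p)) :
  (forall i, P i -> (v i *m M <= W)%MS) -> (rowspan P *m M <= W)%MS.
Proof.
move=> vW; rewrite sumsmxMr_gen; apply/sumsmx_subP => i Pi.
by rewrite genmxE (eqmxMr _ (genmxE _)) vW.
Qed.

Lemma rowspan_coef (P : pred I) (u : 'rV[F]_K) :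
  (u <= rowspan P)%MS -> exists a : I -> F, u = \sum_(i | P i) a i *: v i.
Proof.
case/sub_sumsmxP => w ->.
have aP i : exists a, w i *m <<v i>>%MS == a *: v i.
  have /sub_rVP[a ->] : (w i *m <<v i>>%MS <= v i)%MS.
    by rewrite (submx_trans (submxMl _ _)) ?genmxE.
  by exists a.
exists (fun i => xchoose (aP i)); apply: eq_bigr => i _.
exact/eqP/(xchooseP (aP i)).
Qed.

Lemma rowspan_full_ker (h : 'cV[F]_K) :
  (1%:M <= rowspan xpredT)%MS -> (forall i, v i *m h = 0) -> h = 0.
Proof.
move=> full vh; apply/eqP; rewrite -submx0 -[X in (X <= _)%MS]mul1mx.
apply: submx_trans (submxMr _ full) _.
by apply: rowspan_mul_sub => i _; rewrite vh sub0mx.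
Qed.

End RowSpans.

Section Slabs.
Variables (N d : nat).

Definition bump_coord (m : 'I_d) (x : box N d) : box N d :=
  [ffun l => if l == m then inord (x m).+1 else x l].

Lemma bump_coord_same (m : 'I_d) (x : box N d) :
  (x m < 2 * N)%N -> bump_coord m x m = (x m).+1 :> nat.
Proof. by move=> xm; rewrite ffunE eqxx inordK. Qed.

Lemma bump_coord_other (m l : 'I_d) (x : box N d) :
  l != m -> bump_coord m x l = x l.
Proof. by move=> lm; rewrite ffunE (negPf lm). Qed.

Lemma bump_coordC (m l : 'I_d) (x : box N d) :
  bump_coord m (bump_coord l x) = bump_coord l (bump_coord m x).
Proof.
have [->//|ml] := eqVneq m l.
apply/ffunP => j; rewrite !ffunE; have [->|jm] := eqVneq j m.
  by rewrite (negPf ml).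
by rewrite [l == m]eq_sym (negPf ml).
Qed.

Lemma bump_coord_surj (m : 'I_d) (y : box N d) : (0 < y m)%N ->
  exists x : box N d,
    [/\ y = bump_coord m x & (x m).+1 = y m :> nat].
Proof.
move=> ym; have lt_ym := ltn_ord (y m).
pose x : box N d := [ffun l => if l == m then inord (y m).-1 else y l].
have xm : (x m).+1 = y m :> nat by rewrite ffunE eqxx inordK; lia.
exists x; split=> //; apply/ffunP => l; rewrite ffunE.
have [->|lm] := eqVneq l m; first by rewrite xm inord_val.
by rewrite ffunE (negPf lm).
Qed.

(** Vectors indexed by the box such that a step along the axis m, where the
    box allows it, acts by a fixed matrix M_m.  This covers both the Gram
    vectors of f and the vectors of values of exponentials. *)
Variables (F : fieldType) (K : nat) (v : box N d -> 'rV[F]_K).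
Variable (M : 'I_d -> 'M[F]_K).
Hypothesis v_bump : forall (m : 'I_d) (x : box N d),
  (x m < 2 * N)%N -> v (bump_coord m x) = v x *m M m.
Hypothesis K_le : (K <= 2 * N)%N.

(** The spans W_j of the vectors with x_m < j grow from W_0 = 0, and once
    W_(j+1) = W_j the map M_m propagates the equality to all later indices.
    The 2N+1 inclusions up to W_(2N+1) cannot all be strict in a space of
    dimension K <= 2N, so the last one is an equality.  The set P, saturated
    along m, allows the count to be made inside a slab of another axis. *)
Lemma slab_span (m : 'I_d) (P : pred (box N d)) :
  (forall x : box N d, (x m < 2 * N)%N -> P (bump_coord m x) = P x) ->
  (rowspan v P <= rowspan v (fun x : box N d => P x && (x m < 2 * N)%N))%MS.
Proof.
move=> P_bump.
pose W j := rowspan v (fun x : box N d => P x && (x m < j)%N).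
have W_le j : (W j <= W j.+1)%MS.
  by apply: rowspan_sub => x /andP[Px xj]; apply: rowspan_in; rewrite Px ltnW.
have W_next j : (j < 2 * N)%N -> (W j.+1 <= W j)%MS -> (W j.+2 <= W j.+1)%MS.
  move=> jN stop; apply: rowspan_sub => y /andP[Py]; rewrite ltnS => yj.
  case: (posnP (y m)) => [y0|]; first by apply: rowspan_in; rewrite Py y0.
  case/bump_coord_surj => x [yE xy].
  have xm : (x m < 2 * N)%N by lia.
  rewrite yE v_bump //.
  have : (v x <= W j)%MS.
    by apply: submx_trans stop; apply: rowspan_in; rewrite -P_bump // -yE Py; lia.
  move/(submxMr (M m))/submx_trans; apply.
  apply: rowspan_mul_sub => z /andP[Pz zj].
  rewrite -v_bump; last by lia.
  by apply: rowspan_in; rewrite P_bump ?bump_coord_same ?Pz; lia.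
(* If every inclusion were strict, W (2N+1) would have rank at least
   2N+1 > K. *)
have [j jN stop] : exists2 j, (j <= 2 * N)%N & (W j.+1 <= W j)%MS.
  case: (pickP (fun j : 'I_(2 * N).+1 => (W j.+1 <= W j)%MS)) => [j stop|go].
    by exists j => //; rewrite -ltnS.
  have rkW j : (j <= (2 * N).+1)%N -> (j <= \rank (W j))%N.
    elim: j => [//|j IH] jN; apply: leq_ltn_trans (IH _) _; first by lia.
    by apply: rank_ltmx; rewrite ltmxE W_le (go (Ordinal jN)).
  by have := rkW _ (leqnn _); have := rank_leq_row (W (2 * N)%N.+1); lia.
have stopN : (W (2 * N)%N.+1 <= W (2 * N)%N)%MS.
  have [n nE] : exists n, (2 * N = j + n)%N by exists (2 * N - j)%N; lia.
  rewrite nE; have: (j + n <= 2 * N)%N by rewrite nE.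
  elim: n {nE} => [|n IH] jnN; first by rewrite addn0.
  by rewrite addnS; apply: W_next; [lia | apply: IH; lia].
apply: submx_trans stopN; apply: rowspan_sub => x Px.
by apply: rowspan_in; rewrite Px ltn_ord.
Qed.

Lemma slab_span_all (m : 'I_d) :
  (rowspan v xpredT <= rowspan v (fun x : box N d => x m < 2 * N)%N)%MS.
Proof. exact: (slab_span (P := xpredT)). Qed.

Lemma slab_span_two (m l : 'I_d) :
  (rowspan v xpredT <=
   rowspan v (fun x : box N d => (x m < 2 * N)%N && (x l < 2 * N)%N))%MS.
Proof.
apply: submx_trans (slab_span_all m) _; have [->|lm] := eqVneq l m.
  by apply: rowspan_sub => x xm; apply: rowspan_in; rewrite xm.
by apply: slab_span => x _; rewrite bump_coord_other // eq_sym.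
Qed.

(** M_m acts on vectors with x_m < 2N by moving them inside the box, and those
    vectors already span everything. *)
Lemma rowspan_stable (m : 'I_d) :
  (rowspan v xpredT *m M m <= rowspan v xpredT)%MS.
Proof.
apply: submx_trans (submxMr _ (slab_span_all m)) _.
by apply: rowspan_mul_sub => x xm; rewrite -v_bump // rowspan_in.
Qed.

(** Both products move v_x by one step along each axis whenever x leaves room
    for it in both directions, and such v_x span the space. *)
Lemma bump_matrices_comm (m l : 'I_d) :
  (1%:M <= rowspan v xpredT)%MS -> M m *m M l = M l *m M m.
Proof.
move=> full; have [->//|ml] := eqVneq m l.
apply/eqP; rewrite -subr_eq0 -submx0 -[X in (X <= _)%MS]mul1mx.
apply: submx_trans (submxMr _ (submx_trans full (slab_span_two m l))) _.
apply: rowspan_mul_sub => x /andP[xm xl]; rewrite mulmxBr !mulmxA.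
rewrite -!v_bump // ?bump_coord_other // 1?eq_sym //.
by rewrite bump_coordC subrr sub0mx.
Qed.

End Slabs.

(** * Separation of frequencies *)

Section Lagrange.
Variables (F : fieldType) (I : finType) (K : nat) (z : 'I_K -> I -> F).
Variables (W : 'M[F]_K) (u : 'rV[F]_K).
Hypothesis W_stable : forall m, (W *m diag_mx (\row_k z k m) <= W)%MS.
Hypothesis uW : (u <= W)%MS.

(** Lagrange interpolation for commuting diagonal matrices: each l outside the
    class of k0 differs from it in some coordinate m, and multiplying by
    (diag(z_m) - z_(l,m)) / (z_(k0,m) - z_(l,m)) kills the entry l without
    changing the entries of the class of k0. *)
Lemma stable_class_indicator (k0 : 'I_K) :
  exists2 g : 'rV[F]_K, (g <= W)%MS &
    forall k, g 0 k = if [forall m, z k m == z k0 m] then u 0 k else 0.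
Proof.
have [g gW gE] : exists2 g : 'rV[F]_K, (g <= W)%MS & forall k,
    ([forall m, z k m == z k0 m] -> g 0 k = u 0 k) /\
    (k \in enum 'I_K -> ~~ [forall m, z k m == z k0 m] -> g 0 k = 0).
  elim: (enum 'I_K) => [|l s [g gW gE]]; first by exists u.
  case: (boolP [forall m, z l m == z k0 m]) => [zl|].
    exists g => // k; split=> [|/predU1P[->|ks]]; first exact: (gE k).1.
      by rewrite zl.
    exact: (gE k).2.
  rewrite negb_forall => /existsP[m zlm].
  pose t := (z k0 m - z l m)^-1; have t0 : z k0 m - z l m != 0.
    by rewrite subr_eq0 eq_sym.
  exists (t *: (g *m diag_mx (\row_k z k m) - z l m *: g)) => [|k].
    rewrite scalemx_sub // addmx_sub ?eqmx_opp ?scalemx_sub //.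
    exact: submx_trans (submxMr _ gW) (W_stable m).
  have -> : (t *: (g *m diag_mx (\row_k z k m) - z l m *: g)) 0 k =
      t * (z k m - z l m) * g 0 k.
    by rewrite mul_mx_diag !mxE; ring.
  split=> [zk|/predU1P[->|ks] zk].
  - by rewrite (gE k).1 // (eqP (forallP zk m)) mulVf // mul1r.
  - by rewrite subrr mulr0 mul0r.
  - by rewrite (gE k).2 // mulr0.
exists g => // k; case: ifP => zk; first exact: (gE k).1.
by apply: (gE k).2; rewrite ?mem_enum ?zk.
Qed.

End Lagrange.

Section UnitCircle.
Variable R : realType.

Lemma expi0 : expi (0 : R) = 1.
Proof. by rewrite /expi cos0 sin0. Qed.

Lemma expiD (s t : R) : expi (s + t) = expi s * expi t.
Proof. by rewrite /expi cosD sinD; simpc; congr (_ +i* _)%C; rewrite addrC. Qed.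

Lemma expiN (t : R) : expi (- t) = (expi t)^*.
Proof. by rewrite /expi cosN sinN. Qed.

Lemma expi_conj (t : R) : expi t * (expi t)^* = 1.
Proof. by rewrite -expiN -expiD subrr expi0. Qed.

Lemma expi_neq0 (t : R) : expi t != 0.
Proof.
apply/eqP => e0; have /eqP := expi_conj t.
by rewrite e0 mul0r eq_sym oner_eq0.
Qed.

Lemma expi_2pi_int (z : int) : expi (2 * pi * z%:~R : R) = 1.
Proof.
have nat_case (n : nat) : expi (2 * pi * n%:R : R) = 1.
  elim: n => [|n IH]; first by rewrite mulr0 expi0.
  rewrite -(natr1 n) mulrDr expiD IH mul1r mulr1 mulr_natl.
  by rewrite /expi cos2pi sin2pi.
case: z => n; first by rewrite -pmulrn nat_case.
by rewrite NegzE mulrNz mulrN expiN -pmulrn nat_case rmorph1.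
Qed.

(** After reducing t modulo 2 pi to r in [0, 2 pi), the identity
    cos r = 1 - 2 sin(r/2)^2 gives sin (r/2) = 0 with r/2 in [0, pi). *)
Lemma expi_eq1 (t : R) : expi t = 1 -> exists z : int, t = 2 * pi * z%:~R.
Proof.
move=> et; have pi2 : 0 < 2 * pi :> R by rewrite mulr_gt0 ?pi_gt0.
pose z := Num.floor (t / (2 * pi)); exists z.
have /andP[zl zr] := floor_itv (t / (2 * pi)).
pose r := t - 2 * pi * z%:~R.
have r0 : 0 <= r by rewrite subr_ge0 mulrC -ler_pdivlMr.
have rpi : r < 2 * pi.
  by move: zr; rewrite intrD ltr_pdivrMr // mulrDl mul1r ltrBlDl [_ * z%:~R]mulrC.
have : expi r = 1.
  by rewrite expiD et mul1r expiN expi_2pi_int rmorph1.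
move=> [cr _]; have s0 : sin (r / 2) = 0.
  have := cos_mulr2n (r / 2); rewrite -[(r / 2) *+ 2]mulr_natr divfK ?pnatr_eq0 // cr.
  move: (cos2Dsin2 (r / 2)) => h1 h2; apply/eqP; rewrite -sqrf_eq0.
  by apply/eqP; lra.
have [r00|rn0] := eqVneq r 0; first by move/eqP: r00; rewrite subr_eq0 => /eqP.
have : 0 < sin (r / 2).
  have rp : 0 < r by rewrite lt0r rn0.
  by apply: sin_gt0_pi; rewrite divr_gt0 //= ltr_pdivrMr // mulrC.
by rewrite s0 ltxx.
Qed.

Lemma expi_surj (z : R[i]%C) : z * z^* = 1 -> exists t : R, expi t = z.
Proof.
case: z => a b; rewrite /Num.conj /=; simpc => /eqP; rewrite eq_complex /=.
move=> /andP[/eqP ab _]; have {}ab : a ^+ 2 + b ^+ 2 = 1 by rewrite -ab; ring.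
have ha : -1 <= a <= 1 by apply/andP; split; nra.
have ca : cos (acos a) = a by apply: acosK; rewrite in_itv.
have sa : sin (acos a) = `|b|.
  by rewrite sin_acos // -ab addrAC subrr add0r sqrtr_sqr.
have [b0|b0] := leP 0 b.
  by exists (acos a); rewrite /expi ca sa ger0_norm.
by exists (- acos a); rewrite /expi cosN sinN ca sa ltr0_norm // opprK.
Qed.

Lemma eqfreqP (d : nat) (xi eta : 'rV[R]_d) :
  reflect (eqfreq xi eta) [forall m, expi (xi 0 m) == expi (eta 0 m)].
Proof.
apply: (iffP forallP) => [h m | h m].
  have [z zE] : exists z : int, xi 0 m - eta 0 m = 2 * pi * z%:~R.
    by apply: expi_eq1; rewrite expiD (eqP (h m)) expiN expi_conj.
  by exists z; rewrite -zE addrC subrK.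
by have [z ->] := h m; rewrite expiD expi_2pi_int mulr1.
Qed.

End UnitCircle.

Section Frequencies.
Variables (R : realType) (d : nat).
Implicit Types xi eta : 'rV[R]_d.

Lemma eqfreq_sym xi eta : eqfreq xi eta -> eqfreq eta xi.
Proof.
by move=> h m; have [z ->] := h m; exists (- z); rewrite mulrNz mulrN addrK.
Qed.

Lemma eqfreq_trans eta xi zeta :
  eqfreq xi eta -> eqfreq eta zeta -> eqfreq xi zeta.
Proof.
move=> h1 h2 m; have [y ->] := h1 m; have [z ->] := h2 m.
by exists (z + y); rewrite intrD; ring.
Qed.

Variable M : nat.

Lemma dotp_bump xi (m : 'I_d) (x : box M d) : (x m < 2 * M)%N ->
  dotp xi (bump_coord m x) = dotp xi x + xi 0 m.
Proof.
move=> xm; rewrite /dotp (bigD1 m) //= [in RHS](bigD1 m) //= addrAC.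
congr (_ + _); last first.
  by apply: eq_bigr => l lm; rewrite /Defs.coord bump_coord_other.
have -> : Defs.coord (bump_coord m x) m = Defs.coord x m + 1.
  by rewrite /Defs.coord bump_coord_same // -[(x m).+1]addn1 PoszD addrAC.
by rewrite intrD mulrDr mulr1.
Qed.

Lemma expi_dotp_bump xi (m : 'I_d) (x : box M d) : (x m < 2 * M)%N ->
  expi (dotp xi (bump_coord m x)) = expi (dotp xi x) * expi (xi 0 m).
Proof. by move=> xm; rewrite dotp_bump // expiD. Qed.


Lemma eqfreq_expi xi eta (x : box M d) : eqfreq xi eta ->
  expi (dotp xi x) = expi (dotp eta x).
Proof.
move=> e; suff [z ->] : exists z : int,
    dotp xi x = dotp eta x + 2 * pi * z%:~R.
  by rewrite expiD expi_2pi_int mulr1.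
rewrite /dotp; elim/big_ind2: _ => [|s t s' t' [y ->] [z ->]|m _].
- by exists 0; rewrite mulr0 addr0.
- by exists (y + z); rewrite intrD; ring.
- by have [z ->] := e m; exists (z * Defs.coord x m); rewrite intrM; ring.
Qed.

Definition charv J (xi : 'I_J -> 'rV[R]_d) (x : box M d) : 'rV[R[i]%C]_J :=
  \row_j expi (dotp (xi j) x).

Lemma charv_bump J (xi : 'I_J -> 'rV[R]_d) (m : 'I_d) (x : box M d) :
  (x m < 2 * M)%N ->
  charv xi (bump_coord m x) =
  charv xi x *m diag_mx (\row_j expi (xi j 0 m)).
Proof.
move=> xm; apply/rowP => j.
by rewrite mul_mx_diag !mxE expi_dotp_bump.
Qed.

(** The interpolation is started from the vector of values at a corner of the
    box; its entries are nonzero and equal on each frequency class, so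
    rescaling turns them into 1. *)
Lemma class_indicator_in_charv_span J (xi : 'I_J -> 'rV[R]_d) (j0 : 'I_J) :
  (J <= 2 * M)%N ->
  (\row_j (if [forall m, expi (xi j 0 m) == expi (xi j0 0 m)] then 1 else 0)
    <= rowspan (charv xi) xpredT)%MS.
Proof.
move=> JM; pose corner : box M d := [ffun=> ord0].
pose z j m := expi (xi j 0 m).
have [||g gW gE] := @stable_class_indicator _ 'I_d J z
  (rowspan (charv xi) xpredT) (charv xi corner) _ _ j0.
- move=> m; apply: (rowspan_stable (M := fun m => diag_mx (\row_j z j m))) => //.
  by move=> l x; exact: charv_bump.
- exact: rowspan_in.
set w := expi (dotp (xi j0) corner).
suff -> : \row_j (if [forall m, expi (xi j 0 m) == expi (xi j0 0 m)]
    then 1 else 0) = w^-1 *: g by rewrite scalemx_sub.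
apply/rowP => j; rewrite !mxE gE; case: ifP => [/eqfreqP e|]; last first.
  by rewrite mulr0.
by rewrite mxE (eqfreq_expi _ e) mulVf // expi_neq0.
Qed.

(** Frequencies are compared modulo 2 pi, and repetitions are allowed: this is
    what makes the lemma applicable to the terms of two representations
    taken together. *)
Lemma class_separation J (xi : 'I_J -> 'rV[R]_d) (j0 : 'I_J) :
  (J <= 2 * M)%N ->
  exists a : box M d -> R[i]%C, forall j,
    \sum_x a x * expi (dotp (xi j) x) =
    if [forall m, expi (xi j 0 m) == expi (xi j0 0 m)] then 1 else 0.
Proof.
move=> JM; have [a aE] := rowspan_coef (class_indicator_in_charv_span xi j0 JM).
exists a => j; have := congr1 (fun u : 'rV_J => u 0 j) aE.
rewrite mxE => ->; rewrite summxE; apply: eq_bigr => x _.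
by rewrite !mxE.
Qed.

End Frequencies.

(** * The matrix of the operator *)

Section ToeplitzMatrix.
Local Open Scope sesquilinear_scope.
Variables (R : realType) (N d : nat).
Local Notation C := (R[i]%C).
Local Notation n := #|{: box N d}|.

Definition toeplitz_mx (f : cfun R (2 * N) d) : 'M[C]_n :=
  \matrix_(i, j) f (box_sub (enum_val i) (enum_val j)).

Definition cfun_col (g : cfun R N d) : 'cV[C]_n := \col_i g (enum_val i).

Lemma sum_enum_val (T : nmodType) (F : box N d -> T) :
  \sum_x F x = \sum_(i < n) F (enum_val i).
Proof. by rewrite (reindex _ (onW_bij _ (enum_val_bij (box N d)))). Qed.

Lemma cfun_col_Theta f g : cfun_col (Theta f g) = toeplitz_mx f *m cfun_col g.
Proof.
apply/colP => i; rewrite !mxE ThetaE sum_enum_val.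
by apply: eq_bigr => j _; rewrite !mxE.
Qed.

Lemma cfun_col_surj (u : 'cV[C]_n) : exists g, cfun_col g = u.
Proof.
exists [ffun x => u (enum_rank x) 0]; apply/colP => i.
by rewrite mxE ffunE enum_valK.
Qed.

Lemma inner_col g h : inner h g = ((cfun_col g)^t* *m cfun_col h) 0 0.
Proof.
rewrite /inner mxE sum_enum_val; apply: eq_bigr => i _.
by rewrite !mxE mulrC.
Qed.

Lemma psd_toeplitz f : psd (Theta f) <-> psdmx (toeplitz_mx f).
Proof.
split=> [psdf u | psdf g].
  have [g gE] := cfun_col_surj (u^t*).
  by have := psdf g; rewrite inner_col cfun_col_Theta gE trmxCK mulmxA.
by rewrite inner_col cfun_col_Theta mulmxA -{2}(trmxCK (cfun_col g)).
Qed.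

(** Each inequality comes from a factorization: a rank factorization of the
    matrix spans the image by as many functions as the rank, and a basis of
    the image expresses all columns of the matrix, which are the images of
    the point masses. *)
Lemma oprank_toeplitz f : oprank (Theta f) = \rank (toeplitz_mx f).
Proof.
set A := toeplitz_mx f; apply/eqP; rewrite /oprank eqn_leq; apply/andP; split.
  pose b (k : 'I_(\rank A)) : cfun R N d :=
    [ffun x => col_base A (enum_rank x) k].
  have sub : (limg (Theta f) <= <<codom b>>)%VS.
    apply/subvP => h /memv_imgP[g _ ->].
    have -> : Theta f g = \sum_k ((row_base A *m cfun_col g) k 0) *: b k.
      apply/ffunP => x; rewrite sum_ffunE.
      have := congr1 (fun u : 'cV_n => u (enum_rank x) 0) (cfun_col_Theta f g).
      rewrite mxE enum_rankK => ->; rewrite -/A -{1}(mulmx_base A) -mulmxA mxE.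
      by apply: eq_bigr => k _; rewrite !ffunE mulrC.
    by apply: rpred_sum => k _; rewrite rpredZ // memv_span // codom_f.
  apply: leq_trans (dimvS sub) _; apply: leq_trans (dim_span _) _.
  by rewrite size_codom card_ord.
set V := limg (Theta f); pose e := vbasis V.
have deltaV (j : 'I_n) : Theta f [ffun x => (x == enum_val j)%:R] \in V.
  by rewrite memv_img ?memvf.
pose L : 'M[C]_(n, \dim V) := \matrix_(i, k) (e`_k : cfun R N d) (enum_val i).
pose Q : 'M[C]_(\dim V, n) := \matrix_(k, j)
   coord e k (Theta f [ffun x => (x == enum_val j)%:R]).
suff -> : A = L *m Q by apply: leq_trans (mxrankM_maxl _ _) (rank_leq_col _).
apply/matrixP => i j; have := coord_vbasis (deltaV j).
move/(congr1 (fun h : cfun R N d => h (enum_val i))).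
rewrite sum_ffunE ThetaE (bigD1 (enum_val j)) //= ffunE eqxx mulr1.
rewrite big1 ?addr0 => [|y yj]; last by rewrite ffunE (negPf yj) mulr0.
move=> fE; rewrite !mxE fE; apply: eq_bigr => k _.
by rewrite !ffunE !mxE mulrC.
Qed.

End ToeplitzMatrix.

(** * Decomposition into characters *)

Section Differences.
Variables (N d : nat).

Lemma box_sub_bump (m : 'I_d) (x y : box N d) :
  (x m < 2 * N)%N -> (y m < 2 * N)%N ->
  box_sub (bump_coord m x) (bump_coord m y) = box_sub x y.
Proof.
move=> xm ym; apply: coord_inj => l; rewrite !coord_sub /Defs.coord.
have [->|lm] := eqVneq l m; last by rewrite !bump_coord_other.
by rewrite !bump_coord_same //; lia.
Qed.

Lemma box_sub_surj (z : box (2 * N) d) : exists x y : box N d, z = box_sub x y.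
Proof.
(* In offset coordinates box_sub x y is x + (2N - y), so that z in [0, 4N] has
   to be split into two parts in [0, 2N]. *)
pose x : box N d := [ffun m => inord (z m - minn (z m) (2 * N))].
pose y : box N d := [ffun m => inord (2 * N - minn (z m) (2 * N))].
exists x, y; apply: coord_inj => m; rewrite coord_sub /Defs.coord.
by rewrite !ffunE !inordK; have := ltn_ord (z m); lia.
Qed.

Lemma dotp_box_sub (R : realType) (xi : 'rV[R]_d) (x y : box N d) :
  dotp xi (box_sub x y) = dotp xi x - dotp xi y.
Proof.
rewrite /dotp -sumrB; apply: eq_bigr => m _.
by rewrite coord_sub intrB mulrBr.
Qed.

(** Induction along paths from the corner: it propagates an identity at the
    corner to the whole box by single steps. *)
Lemma box_ind (P : box N d -> Prop) :
  P [ffun=> ord0] ->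
  (forall (m : 'I_d) (x : box N d), (x m < 2 * N)%N -> P x -> P (bump_coord m x)) ->
  forall x, P x.
Proof.
move=> P0 Pbump x; have [n le_n] := ubnP (\sum_m x m)%N.
elim: n x le_n => // n IH x le_n.
case: (pickP (fun m => (0 < x m)%N)) => [m xm|x0]; last first.
  suff -> : x = [ffun=> ord0] by [].
  by apply/ffunP => m; apply/val_inj; rewrite ffunE /=; have := x0 m; lia.
have [y [xE ym]] := bump_coord_surj xm.
have ym2 : (y m < 2 * N)%N by have := ltn_ord (x m); lia.
rewrite xE; apply: Pbump => //; apply: IH.
suff sE : (\sum_l x l = (\sum_l y l).+1)%N by rewrite sE in le_n.
rewrite xE (bigD1 m) //= [in RHS](bigD1 m) //= bump_coord_same // addSn.
by congr (_ + _).+1; apply: eq_bigr => l lm; rewrite bump_coord_other.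
Qed.

End Differences.

Section GramOfShifts.
Local Open Scope sesquilinear_scope.
Variables (C : numClosedFieldType) (N d K : nat).
Variables (phi : box (2 * N) d -> C) (v : box N d -> 'rV[C]_K).
Hypothesis K_le : (K <= 2 * N)%N.
Hypothesis gram : forall x y, (v x *m (v y)^t*) 0 0 = phi (box_sub x y).
Hypothesis v_full : (1%:M <= rowspan v xpredT)%MS.

(** The step matrix comes from comparing the vectors with x_m < 2N and their
    translates, which have the same Gram matrix.  It is unitary because these
    vectors span the space. *)
Lemma bump_unitary : exists U : 'I_d -> 'M[C]_K,
  [/\ forall m, U m \is unitarymx,
      forall m l, U m *m U l = U l *m U m
    & forall (m : 'I_d) (x : box N d),
        (x m < 2 * N)%N -> v (bump_coord m x) = v x *m U m].
Proof.
(* Points at the far face have no translate; their rows are set to 0. *)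
pose A (m : 'I_d) : 'M[C]_(#|{: box N d}|, K) :=
  \matrix_i (if ((enum_val i : box N d) m < 2 * N)%N then v (enum_val i) else 0).
pose B (m : 'I_d) : 'M[C]_(#|{: box N d}|, K) :=
  \matrix_i (if ((enum_val i : box N d) m < 2 * N)%N
             then v (bump_coord m (enum_val i)) else 0).
have mulE (X Y : 'M[C]_(#|{: box N d}|, K)) i j :
    (X *m Y^t*) i j = (row i X *m (row j Y)^t*) 0 0.
  by rewrite !mxE; apply: eq_bigr => l _; rewrite !mxE.
have AB m : A m *m (A m)^t* = B m *m (B m)^t*.
  apply/matrixP => i j; rewrite !mulE !rowK.
  case: ifP => im; last by rewrite !mul0mx.
  case: ifP => jm; last by rewrite !trmx0 !map_mx0 !mulmx0.
  by rewrite !gram box_sub_bump.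
have [U UE] := fin_all_exists (fun m => gram_factor (AB m)).
have v_bump (m : 'I_d) (x : box N d) :
    (x m < 2 * N)%N -> v (bump_coord m x) = v x *m U m.
  move=> xm; have := congr1 (row (enum_rank x)) (UE m).
  by rewrite row_mul !rowK !enum_rankK xm.
exists U; split=> // [m|m l]; last exact: (bump_matrices_comm v_bump).
apply: (gram_factor_unitary (AB m) (UE m)); rewrite -sub1mx.
apply: submx_trans (submx_trans v_full (slab_span_all v_bump K_le m)) _.
apply: rowspan_sub => x xm.
have <- : row (enum_rank x) (A m) = v x by rewrite rowK enum_rankK xm.
exact: row_sub.
Qed.

End GramOfShifts.

Section Spectrum.
Local Open Scope sesquilinear_scope.
Variables (R : realType) (N d K : nat).
Local Notation C := (R[i]%C).
Variables (phi : box (2 * N) d -> C) (v : box N d -> 'rV[C]_K).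
Hypothesis K_le : (K <= 2 * N)%N.
Hypothesis gram : forall x y, (v x *m (v y)^t*) 0 0 = phi (box_sub x y).
Hypothesis v_full : (1%:M <= rowspan v xpredT)%MS.

(** In an orthonormal eigenbasis of the commuting step matrices each coordinate
    of v_x is multiplied by a number of modulus 1 at each step, hence is a
    multiple of an exponential. *)
Lemma gram_characters : exists (xi : 'I_K -> 'rV[R]_d) (w : 'rV[C]_K),
  let v' x := \row_j (w 0 j * expi (dotp (xi j) x)) in
  (1%:M <= rowspan v' xpredT)%MS /\
  forall x y, (v' x *m (v' y)^t*) 0 0 = phi (box_sub x y).
Proof.
have [U [Uu Uc v_bump]] := bump_unitary K_le gram v_full.
have [P [Pu [D UE]]] := commuting_unitary_diag Uu Uc.
have PV : P^t* *m P = 1%:M by apply/mulmx1C/unitarymxP.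
have DE m : diag_mx (D m) = P *m U m *m P^t*.
  by rewrite UE !mulmxA (unitarymxP Pu) mul1mx -mulmxA (unitarymxP Pu) mulmx1.
have D_circle m j : exists t : R, expi t = D m 0 j.
  apply: expi_surj; have : diag_mx (D m) \is unitarymx.
    by rewrite DE !mul_unitarymx // trmxC_unitary.
  move/unitarymxP; rewrite adjmx_diag mulmx_diag.
  by move=> /matrixP /(_ j j); rewrite !mxE eqxx !mulr1n.
have [t tE] := fin_all_exists (fun m => fin_all_exists (D_circle m)).
pose xi (j : 'I_K) : 'rV[R]_d := \row_m t m j.
pose v' x := v x *m P^t*.
have v'_bump (m : 'I_d) (x : box N d) :
    (x m < 2 * N)%N -> v' (bump_coord m x) = v' x *m diag_mx (D m).
  by move=> xm; rewrite /v' v_bump // UE !mulmxA mulmxtVK.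
pose corner : box N d := [ffun=> ord0].
pose w : 'rV[C]_K := \row_j (v' corner 0 j / expi (dotp (xi j) corner)).
have v'E x : v' x = \row_j (w 0 j * expi (dotp (xi j) x)).
  elim/box_ind: x => [|m x xm IH]; apply/rowP => j.
    by rewrite !mxE divfK // expi_neq0.
  rewrite v'_bump // mul_mx_diag mxE IH mxE mxE expi_dotp_bump //.
  by rewrite [xi j 0 m]mxE tE mulrA.
exists xi, w => /=; split=> [|x y]; last first.
  by rewrite -!v'E /v' adjmxM trmxCK !mulmxA mulmxKtV.
rewrite -(unitarymxP Pu).
apply: submx_trans (submxMr _ (submx_trans (submx1 _) v_full)) _.
by apply: rowspan_mul_sub => x _; rewrite -/(v' x) v'E; apply: rowspan_in.
Qed.

End Spectrum.

Section Decomposition.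
Local Open Scope sesquilinear_scope.
Variables (R : realType) (N d K : nat) (f : cfun R (2 * N) d).
Local Notation C := (R[i]%C).

(** The coefficient of the frequency xi_k is |w_k|^2.  If w_k were 0, or xi_k
    and xi_l equal modulo 2 pi, then all the vectors would lie in the
    hyperplane z_k = 0, respectively w_l z_k = w_k z_l, contradicting that
    they span C^K. *)
Lemma psd_expsum : (K <= 2 * N)%N -> psd (Theta f) -> oprank (Theta f) = K ->
  exists (c : 'I_K -> R) (xi : 'I_K -> 'rV[R]_d), is_expsum f c xi.
Proof.
move=> K_le /psd_toeplitz psdf; rewrite oprank_toeplitz => rankf.
have [G fG G_full] := psdmx_gram psdf rankf.
pose v (x : box N d) := row (enum_rank x) G.
have gram x y : (v x *m (v y)^t*) 0 0 = f (box_sub x y).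
  transitivity ((G *m G^t*) (enum_rank x) (enum_rank y)).
    by rewrite !mxE; apply: eq_bigr => l _; rewrite !mxE.
  by rewrite -fG mxE !enum_rankK.
have v_full : (1%:M <= rowspan v xpredT)%MS.
  rewrite -sub1mx in G_full; apply: submx_trans G_full _.
  apply/row_subP => i; rewrite -(enum_valK i); exact: rowspan_in.
have [xi [w [w_full wgram]]] := gram_characters K_le gram v_full.
have w_ker (h : 'cV[C]_K) : (forall x : box N d,
    \sum_j w 0 j * expi (dotp (xi j) x) * h j 0 = 0) -> h = 0.
  move=> hx; apply: rowspan_full_ker w_full _ => x.
  apply/rowP => i; rewrite ord1 !mxE -[RHS](hx x).
  by apply: eq_bigr => j _; rewrite !mxE.
have w_neq0 k : w 0 k != 0.
  apply/eqP => wk0; have : delta_mx k 0 = 0 :> 'cV[C]_K.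
    apply: w_ker => x; apply: big1 => j _; rewrite mxE.
    by have [->|_] := eqVneq j k; rewrite ?wk0 ?mul0r ?mulr0.
  by move/matrixP/(_ k 0)/eqP; rewrite !mxE !eqxx oner_eq0.
have cE k : (complex.Re (`|w 0 k| ^+ 2))%:C%C = `|w 0 k| ^+ 2.
  by rewrite RRe_real // ger0_real // exprn_ge0.
exists (fun k => complex.Re (`|w 0 k| ^+ 2)), xi; split=> [k|k l kl kl_eq|z].
- by rewrite -ltcR cE exprn_gt0 // normr_gt0.
- have : w 0 l *: delta_mx k 0 - w 0 k *: delta_mx l 0 = 0 :> 'cV[C]_K.
    apply: w_ker => x; rewrite (bigD1 k) //= (bigD1 l) 1?eq_sym //= big1 => [|j].
      rewrite !mxE !eqxx (negPf kl) [l == k]eq_sym (negPf kl) /=.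
      by rewrite (eqfreq_expi x kl_eq); ring.
    by case/andP=> jk jl; rewrite !mxE (negPf jk) (negPf jl) /=; ring.
  move/matrixP/(_ k 0)/eqP; rewrite !mxE !eqxx (negPf kl) /= mulr1 mulr0.
  by rewrite subr0 (negPf (w_neq0 l)).
- have [x [y ->]] := box_sub_surj z; rewrite -wgram mxE.
  apply: eq_bigr => k _; rewrite cE !mxE dotp_box_sub expiD expiN normCK.
  by rewrite rmorphM /=; ring.
Qed.

(** The matrix of the operator is E diag(c) E*, where E has the values of the
    exponentials as columns; separating the K distinct frequencies shows that
    E has rank K. *)
Lemma expsum_psd_rank (c : 'I_K -> R) (xi : 'I_K -> 'rV[R]_d) :
  (K <= 2 * N)%N -> is_expsum f c xi -> psd (Theta f) /\ oprank (Theta f) = K.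
Proof.
move=> K_le [c_gt0 xi_neq fE].
pose E : 'M[C]_(#|{: box N d}|, K) := \matrix_i charv xi (enum_val i).
pose D : 'rV[C]_K := \row_k (Num.sqrt (c k))%:C%C.
pose G := E *m diag_mx D.
have fG : toeplitz_mx f = G *m G^t*.
  apply/matrixP => i j; rewrite /G !mxE fE; apply: eq_bigr => k _.
  rewrite !mul_mx_diag !mxE dotp_box_sub expiD expiN rmorphM /=.
  have -> : (c k)%:C%C = (Num.sqrt (c k))%:C%C * ((Num.sqrt (c k))%:C%C)^*.
    rewrite conj_Creal; last by rewrite complex_real.
    by rewrite -rmorphM -expr2 sqr_sqrtr // ltW.
  by ring.
have E_full : row_full E.
  rewrite -sub1mx; apply/row_subP => k; rewrite rowE mulmx1.
  apply: (@submx_trans _ _ _ _ _ _ (rowspan (@charv R d N K xi) xpredT)).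
    have := class_indicator_in_charv_span (M := N) xi k K_le.
    congr (_ <= _)%MS; apply/rowP => j; rewrite !mxE eqxx /=.
    have [->|jk] := eqVneq j k; first by case: forallP => // -[].
    by case: eqfreqP => // /(xi_neq _ _ jk).
  apply: rowspan_sub => x _.
  have <- : row (enum_rank x) E = charv xi x by rewrite rowK enum_rankK.
  exact: row_sub.
have G_full : row_full G.
  rewrite /row_full mxrankMfree ?E_full // row_free_unit unitmxE det_diag.
  rewrite unitfE; apply/prodf_neq0 => k _; rewrite mxE.
  by rewrite (inj_eq (@complexI R)) gt_eqF ?sqrtr_gt0.
split; last by rewrite oprank_toeplitz fG rank_gram.
apply/psd_toeplitz => u.
have -> : u *m toeplitz_mx f *m u^t* = (u *m G) *m (u *m G)^t*.
  by rewrite fG adjmxM !mulmxA.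
by rewrite mulmx_adj_diag sumr_ge0 // => k _; rewrite exprn_ge0.
Qed.

(** A functional that is 1 on the exponentials with frequency xi'_k and 0 on all
    others occurring in either representation computes from f the total
    coefficient of that frequency.  It is c'_k > 0 in one representation, so
    the other one must contain the frequency too, with the same
    coefficient. *)
Lemma expsum_term_match (c c' : 'I_K -> R) (xi xi' : 'I_K -> 'rV[R]_d) :
  (K <= 2 * N)%N -> is_expsum f c xi -> is_expsum f c' xi' ->
  forall k, exists2 l, c' k = c l & eqfreq (xi' k) (xi l).
Proof.
move=> K_le [c_gt0 xi_neq fE] [c'_gt0 xi'_neq fE'] k.
pose zeta (j : 'I_(K + K)) :=
  match split j with inl l => xi l | inr l => xi' l end.
have zetal l : zeta (lshift K l) = xi l by rewrite /zeta (unsplitK (inl l)).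
have zetar l : zeta (rshift K l) = xi' l by rewrite /zeta (unsplitK (inr l)).
have [|a aE] := @class_separation R d (2 * N) _ zeta (rshift K k); first by lia.
have sum_class (b : 'I_K -> R) (eta : 'I_K -> 'rV[R]_d) :
    (forall x, f x = \sum_l (b l)%:C%C * expi (dotp (eta l) x)) ->
    (forall l, exists j, eta l = zeta j) ->
    \sum_x a x * f x =
    \sum_(l | [forall m, expi (eta l 0 m) == expi (xi' k 0 m)]) (b l)%:C%C.
  move=> fb etaz; under eq_bigr => x _ do rewrite fb mulr_sumr.
  rewrite exchange_big [RHS]big_mkcond /=; apply: eq_bigr => l _.
  have [j lj] := etaz l; have := aE j; rewrite -lj zetar => aj.
  under eq_bigr => x _ do rewrite mulrCA.
  by rewrite -mulr_sumr aj; case: ifP => _; rewrite ?mulr1 ?mulr0.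
have single (b : 'I_K -> R) (eta : 'I_K -> 'rV[R]_d) l :
    (forall i j, i != j -> ~ eqfreq (eta i) (eta j)) ->
    eqfreq (eta l) (xi' k) ->
    \sum_(l | [forall m, expi (eta l 0 m) == expi (xi' k 0 m)]) (b l)%:C%C =
    (b l)%:C%C.
  move=> neq lk; rewrite (bigD1 l) /=; last exact/eqfreqP.
  rewrite big1 ?addr0 // => j /andP[/eqfreqP jk jl]; case: (neq _ _ jl).
  exact: eqfreq_trans jk (eqfreq_sym lk).
have := sum_class _ _ fE (fun l => ex_intro _ _ (esym (zetal l))).
rewrite (sum_class _ _ fE' (fun l => ex_intro _ _ (esym (zetar l)))).
rewrite (single c' xi' k) //; last by move=> m; exists 0; rewrite mulr0 addr0.
case: (pickP (fun l => [forall m, expi (xi l 0 m) == expi (xi' k 0 m)])).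
  move=> l /eqfreqP lk; rewrite (single c xi l) // => /complexI cE.
  by exists l => //; apply: eqfreq_sym.
move=> none; rewrite big_pred0 // => /complexI c0.
by have := c'_gt0 k; rewrite c0 ltxx.
Qed.

End Decomposition.

Theorem theorem5p1 (R : realType) (N d K : nat) (f : cfun R (2 * N) d)
    (hN : (0 < N)%N) (hd : (0 < d)%N) (hK : (K <= 2 * N)%N) :
  (psd (Theta f) -> oprank (Theta f) = K ->
     exists (c : 'I_K -> R) (xi : 'I_K -> 'rV[R]_d),
       is_expsum f c xi /\
       forall (c' : 'I_K -> R) (xi' : 'I_K -> 'rV[R]_d),
         is_expsum f c' xi' ->
         exists s : {perm 'I_K},
           forall k, c' k = c (s k) /\ eqfreq (xi' k) (xi (s k)))
  /\
  ((exists (c : 'I_K -> R) (xi : 'I_K -> 'rV[R]_d), is_expsum f c xi) ->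
     psd (Theta f) /\ oprank (Theta f) = K).
Proof.
split=> [psdf rankf | [c [xi fE]]]; last exact: expsum_psd_rank hK fE.
have [c [xi fE]] := psd_expsum hK psdf rankf.
exists c, xi; split=> // c' xi' fE'.
have [s cE sE] := fin_all_exists2 (expsum_term_match hK fE fE').
have s_inj : injective s.
  move=> k l skl; apply/eqP; apply: contraT => kl.
  have [_ xi'_neq _] := fE'; case: (xi'_neq _ _ kl).
  apply: eqfreq_trans (sE k) _; rewrite skl.
  exact: eqfreq_sym (sE l).
by exists (perm s_inj) => k; rewrite permE.
Qed.
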